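(* Let $K$ be a field and $\mathbb{X}\subseteq\mathbb{P}^n_K$ a $0$-dimensional locally Gorenstein scheme with support $\{p_1,\dots,p_s\}$, no $p_j$ on the hyperplane $X_0=0$. For $j=1,\dots,s$ let $\nu_j=\dim_K\mathcal{O}_{\mathbb{X},p_j}$, let $\{e_{j1},\dots,e_{j\nu_j}\}$ be a $K$-basis of $\mathcal{O}_{\mathbb{X},p_j}$, let $\overline\sigma_j$ be a trace map of $\mathcal{O}_{\mathbb{X},p_j}/K$, let $\{e'_{j1},\dots,e'_{j\nu_j}\}$ be the $K$-basis of $\mathcal{O}_{\mathbb{X},p_j}$ dual to $\{e_{j1},\dots,e_{j\nu_j}\}$ with respect to $\overline\sigma_j$, i.e. $\overline\sigma_j(e_{jk}e'_{jk'})=\delta_{kk'}$ (Kronecker delta), and set $$f_{jk_j}=\tilde\imath^{-1}((0,\dots,0,e_{jk_j}T_j^{r_{\mathbb{X}}},0,\dots,0))\in R_{r_{\mathbb{X}}},\qquad \widetilde f_{jk_j}=\tilde\imath^{-1}((0,\dots,0,e'_{jk_j}T_j^{r_{\mathbb{X}}},0,\dots,0))\in R_{r_{\mathbb{X}}}$$ for $k_j=1,\dots,\nu_j$. Let $\sigma$ be the homogeneous trace map of degree zero of $Q^h(R)/L_0$ induced by $\overline\sigma_1,\dots,\overline\sigma_s$, and let $\Phi:\omega_R(1)\hookrightarrow Q^h(R)$ be the associated monomorphism of graded $R$-modules with image $\mathfrak{C}^\sigma_{\mathbb{X}}$. Let $i\ge0$ and $\varphi\in(\omega_R)_{i-r_{\mathbb{X}}+1}$,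 and write $\varphi(f_{jk_j})=c_{jk_j}x_0^i$ with $c_{jk_j}\in K$. Then $$\Phi(\varphi)=\Big(\sum_{k_1=1}^{\nu_1}c_{1k_1}e'_{1k_1}T_1^{i-r_{\mathbb{X}}},\dots,\sum_{k_s=1}^{\nu_s}c_{sk_s}e'_{sk_s}T_s^{i-r_{\mathbb{X}}}\Big)\in(\mathfrak{C}^\sigma_{\mathbb{X}})_{i-r_{\mathbb{X}}}.$$ In particular, $\Phi(\varphi)$ can be identified with the element $x_0^{i-2r_{\mathbb{X}}}\big(\sum_{j=1}^s\sum_{k_j=1}^{\nu_j}c_{jk_j}\widetilde f_{jk_j}\big)$ of $R_{x_0}\cong Q^h(R)$.
   Context: $P=K[X_0,\dots,X_n]$ has the standard grading, $I_{\mathbb{X}}\subseteq P$ is the (saturated) homogeneous vanishing ideal of $\mathbb{X}$, $R=P/I_{\mathbb{X}}$. The residue class $x_0$ of $X_0$ in $R$ is a non-zerodivisor. $\mathcal{O}_{\mathbb{X},p_j}$ is the local ring at $p_j$; $\deg(\mathbb{X})=\sum_j\nu_j$. $r_{\mathbb{X}}$ is the least integer such that $\dim_KR_i=\deg(\mathbb{X})$ for all $i\ge r_{\mathbb{X}}$. $\mathbb{X}$ is locally Gorenstein if every $\mathcal{O}_{\mathbb{X},p_j}$ is a Gorenstein ring. $Q^h(R)$ is the localization of $R$ at all homogeneous non-zerodivisors; $Q^h(R)=R_{x_0}\cong\prod_{j=1}^s\mathcal{O}_{\mathbb{X},p_j}[T_j,T_j^{-1}]$ with $\deg T_j=1$,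 via the injection $\tilde\imath:R\to Q^h(R)$, $\tilde\imath(f)=(f_{p_1}T_1^i,\dots,f_{p_s}T_s^i)$ for $f\in R_i$, where $f_{p_j}$ is the germ of $f$ at $p_j$ (the image of $f/x_0^i$ in $\mathcal{O}_{\mathbb{X},p_j}$). In particular $x_0\mapsto(T_1,\dots,T_s)$, and $\tilde\imath$ is bijective in degrees $\ge r_{\mathbb{X}}$. $L_0=K[x_0,x_0^{-1}]$. A trace map of $\mathcal{O}_{\mathbb{X},p_j}/K$ is an $\mathcal{O}_{\mathbb{X},p_j}$-basis $\overline\sigma_j$ of $\mathrm{Hom}_K(\mathcal{O}_{\mathbb{X},p_j},K)$; it exists because $\mathcal{O}_{\mathbb{X},p_j}$ is Gorenstein. A homogeneous trace map of degree zero of $Q^h(R)/L_0$ is a degree-$0$ homogeneous $Q^h(R)$-basis of the graded module $\underline{\mathrm{Hom}}_{L_0}(Q^h(R),L_0)$. The one induced by the $\overline\sigma_j$ is the $L_0$-linear map with $\sigma((a_1,\dots,a_s))=\sum_j\overline\sigma_j(a_j)$ for $(a_1,\dots,a_s)\in\prod_j\mathcal{O}_{\mathbb{X},p_j}$. $\omega_R=\underline{\mathrm{Hom}}_{K[x_0]}(R,K[x_0])(-1)$ is the canonical module of $R$. $\Phi$ is the composition $\omega_R(1)\hookrightarrow\underline{\mathrm{Hom}}_{L_0}(Q^h(R),L_0)=Q^h(R)\cdot\sigma\cong Q^h(R)$, $\varphi\mapsto\varphi\otimes\mathrm{id}_{L_0}$, where the last isomorphism sends $g\sigma$ to $g$;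 its image is the Dedekind complementary module $\mathfrak{C}^\sigma_{\mathbb{X}}$. *)

(* Defs.v *)
From HB Require Import structures.
From mathcomp Require Import all_boot all_order all_algebra.
From mathcomp Require Import boolp classical_sets.
From mathcomp Require Import mpoly.
From mathcomp Require Import ring.

Set Implicit Arguments.
Unset Strict Implicit.
Unset Printing Implicit Defensive.

Import GRing.Theory.

Local Open Scope ring_scope.
Local Open Scope quotient_scope.

(* Localization of a commutative ring at a multiplicative set.  Zero is
   excluded, so that the localization is a nonzero ring.                      *)

Record mulset (R : comNzRingType) := MulSet {
  mset :> {pred R};
  mset1 : 1 \in mset;
  msetM : forall x y, x \in mset -> y \in mset -> x * y \in mset;
  mset0 : 0 \notin mset
}.

Section Localization.
Variables (R : comNzRingType) (S : mulset R).

Definition fracpair : Type := (R * {s : R | s \in mset S})%type.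
HB.instance Definition _ := Choice.on fracpair.

Implicit Types x y z : fracpair.

Definition numer x : R := x.1.
Definition denom x : R := val x.2.
Definition mkfrac (a s : R) (Ss : s \in mset S) : fracpair := (a, exist _ s Ss).

Lemma denomP x : denom x \in mset S.
Proof. exact: valP x.2. Qed.

Lemma numerE a s (Ss : s \in mset S) : numer (mkfrac a Ss) = a.
Proof. by []. Qed.

Lemma denomE a s (Ss : s \in mset S) : denom (mkfrac a Ss) = s.
Proof. by []. Qed.

Let fracE := (numerE, denomE).

(* The factor u is needed since R may have zero divisors. *)
Definition loc_equiv x y : bool :=
  `[< exists2 u, u \in mset S &
        u * (numer x * denom y) = u * (numer y * denom x) >].

Lemma loc_equivP x y :
  reflect (exists2 u, u \in mset S &
             u * (numer x * denom y) = u * (numer y * denom x))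
          (loc_equiv x y).
Proof. exact: asboolP. Qed.

Lemma loc_equiv_is_equiv : equiv_class_of loc_equiv.
Proof.
split.
- by move=> x; apply/loc_equivP; exists 1; rewrite ?mset1.
- move=> x y; apply/loc_equivP/loc_equivP => -[u Su e]; by exists u.
move=> y x z /loc_equivP[u Su e] /loc_equivP[v Sv e'].
apply/loc_equivP; exists (u * v * denom y).
  by rewrite !msetM // denomP.
have -> : u * v * denom y * (numer x * denom z) =
          v * denom z * (u * (numer x * denom y)) by ring.
rewrite e; have -> : v * denom z * (u * (numer y * denom x)) =
                     u * denom x * (v * (numer y * denom z)) by ring.
by rewrite e'; ring.
Qed.

Canonical loc_equivR := EquivRelPack loc_equiv_is_equiv.
Canonical loc_encModRel := defaultEncModRel loc_equiv.

Definition loc : Type := {eq_quot loc_equiv}.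
HB.instance Definition _ : EqQuotient _ loc_equiv loc := EqQuotient.on loc.
HB.instance Definition _ := Choice.on loc.

Lemma eq_locP x y :
  reflect (exists2 u, u \in mset S &
             u * (numer x * denom y) = u * (numer y * denom x))
          (\pi_loc x == \pi_loc y).
Proof. by rewrite piE; apply: loc_equivP. Qed.

Lemma eq_loc x y : numer x * denom y = numer y * denom x ->
  \pi_loc x = \pi_loc y.
Proof. by move=> e; apply/eqP/eq_locP; exists 1; rewrite ?mset1 ?e. Qed.

Let add_pair x y : fracpair :=
  mkfrac (numer x * denom y + numer y * denom x) (msetM (denomP x) (denomP y)).
Let mul_pair x y : fracpair :=
  mkfrac (numer x * numer y) (msetM (denomP x) (denomP y)).
Let opp_pair x : fracpair := mkfrac (- numer x) (denomP x).

Definition loc_of (a : R) : loc := \pi_loc (mkfrac a (mset1 S)).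
Definition loc_add := lift_op2 loc add_pair.
Definition loc_mul := lift_op2 loc mul_pair.
Definition loc_opp := lift_op1 loc opp_pair.

Lemma pi_loc_add : {morph \pi_loc : x y / add_pair x y >-> loc_add x y}.
Proof.
move=> x y; unlock loc_add; apply/eqP/eq_locP.
have /eqP/eq_locP[u Su e] := esym (reprK (\pi_loc x)).
have /eqP/eq_locP[v Sv e'] := esym (reprK (\pi_loc y)).
set x' := repr _ in e *; set y' := repr (\pi_loc y) in e' *.
exists (u * v); first exact: msetM.
rewrite !fracE.
transitivity (v * denom y * denom y' * (u * (numer x * denom x')) +
              u * denom x * denom x' * (v * (numer y * denom y'))); first by ring.
by rewrite e e'; ring.
Qed.
Canonical pi_loc_add_morph := PiMorph2 pi_loc_add.

Lemma pi_loc_mul : {morph \pi_loc : x y / mul_pair x y >-> loc_mul x y}.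
Proof.
move=> x y; unlock loc_mul; apply/eqP/eq_locP.
have /eqP/eq_locP[u Su e] := esym (reprK (\pi_loc x)).
have /eqP/eq_locP[v Sv e'] := esym (reprK (\pi_loc y)).
set x' := repr _ in e *; set y' := repr (\pi_loc y) in e' *.
exists (u * v); first exact: msetM.
rewrite !fracE.
transitivity ((u * (numer x * denom x')) * (v * (numer y * denom y')));
  first by ring.
by rewrite e e'; ring.
Qed.
Canonical pi_loc_mul_morph := PiMorph2 pi_loc_mul.

Lemma pi_loc_opp : {morph \pi_loc : x / opp_pair x >-> loc_opp x}.
Proof.
move=> x; unlock loc_opp; apply/eqP/eq_locP.
have /eqP/eq_locP[u Su e] := esym (reprK (\pi_loc x)).
set x' := repr _ in e *; exists u => //.
rewrite !fracE.
by rewrite !mulNr !mulrN e.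
Qed.
Canonical pi_loc_opp_morph := PiMorph1 pi_loc_opp.

Lemma loc_addA : associative loc_add.
Proof.
move=> x y z; rewrite -[x]reprK -[y]reprK -[z]reprK !piE; apply: eq_loc.
by rewrite !fracE; ring.
Qed.

Lemma loc_addC : commutative loc_add.
Proof.
move=> x y; rewrite -[x]reprK -[y]reprK !piE; apply: eq_loc.
by rewrite !fracE; ring.
Qed.

Lemma loc_add0 : left_id (loc_of 0) loc_add.
Proof.
move=> x; rewrite -[x]reprK /loc_of !piE; apply: eq_loc.
by rewrite !fracE; ring.
Qed.

Lemma loc_addN : left_inverse (loc_of 0) loc_opp loc_add.
Proof.
move=> x; rewrite -[x]reprK /loc_of !piE; apply: eq_loc.
by rewrite !fracE; ring.
Qed.

HB.instance Definition _ :=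
  GRing.isZmodule.Build loc loc_addA loc_addC loc_add0 loc_addN.

Lemma loc_mulA : associative loc_mul.
Proof.
move=> x y z; rewrite -[x]reprK -[y]reprK -[z]reprK !piE; apply: eq_loc.
by rewrite !fracE; ring.
Qed.

Lemma loc_mulC : commutative loc_mul.
Proof.
move=> x y; rewrite -[x]reprK -[y]reprK !piE; apply: eq_loc.
by rewrite !fracE; ring.
Qed.

Lemma loc_mul1 : left_id (loc_of 1) loc_mul.
Proof.
move=> x; rewrite -[x]reprK /loc_of !piE; apply: eq_loc.
by rewrite !fracE; ring.
Qed.

Lemma loc_mulDl : left_distributive loc_mul loc_add.
Proof.
move=> x y z; rewrite -[x]reprK -[y]reprK -[z]reprK !piE; apply: eq_loc.
by rewrite !fracE; ring.
Qed.

Lemma loc_1_neq0 : loc_of 1 != loc_of 0.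
Proof.
apply/negP => /eq_locP[u Su]; rewrite !fracE mul0r !mulr0 !mulr1.
by move=> u0; move: Su; rewrite u0 (negPf (mset0 S)).
Qed.

HB.instance Definition _ := GRing.Zmodule_isComNzRing.Build loc
  loc_mulA loc_mulC loc_mul1 loc_mulDl loc_1_neq0.

Lemma loc_of_is_zmod_morphism : zmod_morphism loc_of.
Proof.
move=> a b; rewrite /loc_of [LHS]/= -[RHS]/(loc_add _ (loc_opp _)) !piE.
by apply: eq_loc; rewrite !fracE; ring.
Qed.

Lemma loc_of_is_monoid_morphism : monoid_morphism loc_of.
Proof.
split=> // a b; rewrite /loc_of -[RHS]/(loc_mul _ _) !piE.
by apply: eq_loc; rewrite !fracE; ring.
Qed.

HB.instance Definition _ :=
  GRing.isZmodMorphism.Build R loc loc_of loc_of_is_zmod_morphism.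
HB.instance Definition _ :=
  GRing.isMonoidMorphism.Build R loc loc_of loc_of_is_monoid_morphism.

Implicit Types u v : loc.

Definition loc_unit : {pred loc} := [pred u | `[< exists v, v * u = 1 >]].
Definition loc_inv u : loc := xget u [set v | v * u = 1].

Lemma loc_mulVx : {in loc_unit, left_inverse 1 loc_inv *%R}.
Proof. by move=> u /asboolP[v vu]; rewrite /loc_inv; case: xgetP => // /(_ v). Qed.

Lemma loc_unitPl u v : v * u = 1 -> loc_unit u.
Proof. by move=> vu; apply/asboolP; exists v. Qed.

Lemma loc_inv_out : {in [predC loc_unit], loc_inv =1 id}.
Proof.
move=> u /asboolP uN; rewrite /loc_inv; case: xgetP => // v _ vu.
by case: uN; exists v.
Qed.

HB.instance Definition _ := GRing.ComNzRing_hasMulInverse.Build loc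
  loc_mulVx loc_unitPl loc_inv_out.

Lemma loc_of_unit s : s \in mset S -> loc_of s \is a GRing.unit.
Proof.
move=> Ss; apply/unitrPr; exists (\pi_loc (mkfrac 1 Ss)).
rewrite -[LHS]/(loc_mul _ _) -[RHS]/(loc_of 1) /loc_of !piE.
by apply: eq_loc; rewrite !fracE; ring.
Qed.

Lemma locE (x : fracpair) : \pi_loc x = loc_of (numer x) / loc_of (denom x).
Proof.
apply: (canRL (mulrK (loc_of_unit (denomP x)))).
rewrite -[LHS]/(loc_mul _ _) /loc_of !piE.
by apply: eq_loc; rewrite !fracE; ring.
Qed.

(* The map a / s |-> f a / f s.  It does not depend on the choice of
   representatives as soon as f is a ring morphism mapping S to units.              *)
Definition loc_lift (B : unitRingType) (f : R -> B) (u : loc) : B :=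
  f (numer (repr u)) / f (denom (repr u)).

End Localization.

Arguments loc_of {R} S a.
Arguments loc_lift {R S B} f u.

Section LocalizationAlgebra.
Variables (K : comNzRingType) (A : comAlgType K) (S : mulset A).

Definition loc_scale (c : K) (u : loc S) : loc S := loc_of S c%:A * u.

Lemma loc_scaleA c d u : loc_scale c (loc_scale d u) = loc_scale (c * d) u.
Proof. by rewrite /loc_scale mulrA -rmorphM /= -scalerAl mul1r scalerA. Qed.

Lemma loc_scale1 : left_id 1 loc_scale.
Proof. by move=> u; rewrite /loc_scale scale1r rmorph1 mul1r. Qed.

Lemma loc_scaleDr : right_distributive loc_scale +%R.
Proof. by move=> c u v; rewrite /loc_scale mulrDr. Qed.

Lemma loc_scaleDl u : {morph loc_scale^~ u : c d / c + d}.
Proof. by move=> c d; rewrite /loc_scale scalerDl rmorphD mulrDl. Qed.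

HB.instance Definition _ := GRing.Zmodule_isLmodule.Build K (loc S)
  loc_scaleA loc_scale1 loc_scaleDr loc_scaleDl.

Lemma loc_scaleAl c (u v : loc S) : c *: (u * v) = (c *: u) * v.
Proof. by rewrite -[LHS]/(loc_scale _ _) /loc_scale mulrA. Qed.

HB.instance Definition _ := GRing.Lmodule_isLalgebra.Build K (loc S) loc_scaleAl.
HB.instance Definition _ := GRing.Lalgebra_isComAlgebra.Build K (loc S).

Lemma loc_ofZ c (a : A) : loc_of S (c *: a) = c *: loc_of S a.
Proof.
by rewrite -[RHS]/(loc_scale _ _) /loc_scale -rmorphM /= -scalerAl mul1r.
Qed.
End LocalizationAlgebra.

(* Laurent polynomials A[T, T^-1], with T = laurX A. *)
Section Laurent.
Variable A : comNzRingType.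

Definition powX : {pred {poly A}} := [pred p | `[< exists k, p = 'X^k >]].

Lemma powX1 : 1 \in powX. Proof. by apply/asboolP; exists 0%N; rewrite expr0. Qed.

Lemma powXM p q : p \in powX -> q \in powX -> p * q \in powX.
Proof.
move=> /asboolP[k ->] /asboolP[l ->]; apply/asboolP; exists (k + l)%N.
by rewrite exprD.
Qed.

Lemma powX0 : 0 \notin powX.
Proof.
apply/asboolP => -[k /esym/eqP]; apply/negP.
exact: monic_neq0 (monicXn _ _).
Qed.

Definition powX_mulset := MulSet powX1 powXM powX0.

Definition laurent : Type := loc powX_mulset.
HB.instance Definition _ := GRing.ComUnitRing.on laurent.
HB.instance Definition _ := GRing.ComAlgebra.on laurent.

Definition laur_of (p : {poly A}) : laurent := loc_of powX_mulset p.
Definition laurX : laurent := laur_of 'X.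
End Laurent.

Definition is_basis (K : nzRingType) (V : lmodType K) (W : set V) (m : nat)
    (b : 'I_m -> V) : Prop :=
  (forall k, W (b k)) /\
  forall x, W x -> exists! c : {ffun 'I_m -> K}, x = \sum_k c k *: b k.

Definition has_dim (K : fieldType) (V : lmodType K) (W : set V) (m : nat) :=
  exists b : 'I_m -> V, is_basis W b.

Definition noetherian (A : comNzRingType) : Prop :=
  forall J : set A,
    J 0 -> (forall a x y, J x -> J y -> J (a * x + y)) ->
    exists m (g : 'I_m -> A),
      forall x, J x <-> exists a : 'I_m -> A, x = \sum_k a k * g k.

Definition injective_module (A : nzRingType) (E : lmodType A) : Prop :=
  forall (M N : lmodType A) (u : {linear M -> N}) (f : {linear M -> E}),
    injective u -> exists g : {linear N -> E}, forall x, g (u x) = f x.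

(* M has a finite injective resolution. *)
Inductive finite_injdim (A : nzRingType) : lmodType A -> Prop :=
| FiniteInjdim0 (M : lmodType A) : injective_module M -> finite_injdim M
| FiniteInjdimS (M E C : lmodType A) (u : {linear M -> E}) (v : {linear E -> C}) :
    injective_module E -> injective u -> (forall y, exists x, v x = y) ->
    (forall x, v x = 0 <-> exists y, x = u y) ->
    finite_injdim C -> finite_injdim M.

(* Adequate for local rings A only: no localization at primes is taken. *)
Definition gorenstein_local (A : comNzRingType) : Prop :=
  noetherian A /\ finite_injdim (A^o : lmodType A).

Definition trace_map (K : fieldType) (A : comAlgType K) (s : {linear A -> K^o}) :=
  forall l : {linear A -> K^o}, exists! g : A, forall x, l x = s (g * x).

(* Closed subschemes of P^n, given by their saturated homogeneous vanishing
   ideals.  Being an idealr includes 1 \notin I, i.e. the scheme is not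
   empty.                                                                     *)

Record scheme (K : fieldType) (n : nat) := Scheme {
  vanishing_ideal :> idealr {mpoly K[n.+1]};
  vanishing_ideal_homog : forall F d,
    vanishing_ideal F -> vanishing_ideal (pihomog mdeg d F);
  vanishing_ideal_saturated : forall F,
    (exists k, forall m : 'X_{1..n.+1}, mdeg m = k ->
       vanishing_ideal ('X_[m] * F)) ->
    vanishing_ideal F
}.

Section CoordinateRing.
Variables (K : fieldType) (n : nat) (X : scheme K n).

Definition hcr : Type := {ideal_quot (vanishing_ideal X)}.
HB.instance Definition _ := GRing.ComNzRing.on hcr.

Definition cls (F : {mpoly K[n.+1]}) : hcr := \pi_({ideal_quot (vanishing_ideal X)}) F.

Lemma cls_is_zmod_morphism : zmod_morphism cls.
Proof. exact: raddfB. Qed.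
Lemma cls_is_monoid_morphism : monoid_morphism cls.
Proof. by split; [exact: rmorph1 | exact: rmorphM]. Qed.
HB.instance Definition _ :=
  GRing.isZmodMorphism.Build {mpoly K[n.+1]} hcr cls cls_is_zmod_morphism.
HB.instance Definition _ :=
  GRing.isMonoidMorphism.Build {mpoly K[n.+1]} hcr cls cls_is_monoid_morphism.

Definition hcr_scale (c : K) (f : hcr) : hcr := cls c%:MP * f.

Lemma hcr_scaleA c d f : hcr_scale c (hcr_scale d f) = hcr_scale (c * d) f.
Proof. by rewrite /hcr_scale mulrA -rmorphM /= -mpolyCM. Qed.

Lemma hcr_scale1 : left_id 1 hcr_scale.
Proof. by move=> f; rewrite /hcr_scale rmorph1 mul1r. Qed.

Lemma hcr_scaleDr : right_distributive hcr_scale +%R.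
Proof. by move=> c f g; rewrite /hcr_scale mulrDr. Qed.

Lemma hcr_scaleDl f : {morph hcr_scale^~ f : c d / c + d}.
Proof. by move=> c d; rewrite /hcr_scale mpolyCD rmorphD mulrDl. Qed.

HB.instance Definition _ := GRing.Zmodule_isLmodule.Build K hcr
  hcr_scaleA hcr_scale1 hcr_scaleDr hcr_scaleDl.

Lemma hcr_scaleAl c (f g : hcr) : c *: (f * g) = (c *: f) * g.
Proof. by rewrite -[LHS]/(hcr_scale _ _) /hcr_scale mulrA. Qed.

HB.instance Definition _ := GRing.Lmodule_isLalgebra.Build K hcr hcr_scaleAl.
HB.instance Definition _ := GRing.Lalgebra_isComAlgebra.Build K hcr.

Definition hvar (l : 'I_n.+1) : hcr := cls 'X_l.
Definition x0 : hcr := hvar ord0.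

Definition hdeg (d : nat) : set hcr :=
  [set f | exists2 F, F \is d.-homog & f = cls F].
Definition homogeneous (f : hcr) : Prop := exists d, hdeg d f.
Definition hcomp (d : nat) (f : hcr) : hcr := cls (pihomog mdeg d (repr f)).

Lemma hdeg1 : hdeg 0%N 1.
Proof. by exists 1; rewrite ?rmorph1 ?dhomog1. Qed.

Lemma hdegM d e f g : hdeg d f -> hdeg e g -> hdeg (d + e)%N (f * g).
Proof.
move=> [F hF ->] [G hG ->]; exists (F * G); last by rewrite rmorphM.
exact: dhomogM.
Qed.

Lemma hdegD d f g : hdeg d f -> hdeg d g -> hdeg d (f + g).
Proof.
move=> [F hF ->] [G hG ->]; exists (F + G); last by rewrite rmorphD.
exact: rpredD.
Qed.

Lemma hdegZ d c f : hdeg d f -> hdeg d (c *: f).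
Proof.
move=> [F hF ->]; exists (c%:MP * F); last by rewrite rmorphM.
by rewrite mul_mpolyC; apply: rpredZ.
Qed.

(* Points of X = Proj R, i.e. relevant homogeneous primes of R. *)
Record scheme_point := SchemePoint {
  pideal :> prime_idealr hcr;
  point_homog : forall f d, pideal f -> pideal (hcomp d f);
  point_relevant : exists l, ~~ pideal (hvar l)
}.

Definition zero_dimensional : Prop :=
  inhabited scheme_point /\
  forall p q : scheme_point, (forall f, p f -> q f) -> forall f, q f -> p f.

Definition is_support s (p : 'I_s -> scheme_point) : Prop :=
  forall q : scheme_point, exists! j, forall f, p j f = q f.

Section LocalRing.
Variable p : scheme_point.

Definition hcompl : {pred hcr} := [pred f | `[< homogeneous f >] && ~~ p f].

Lemma hcompl1 : 1 \in hcompl.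
Proof.
apply/andP; split; first by apply/asboolP; exists 0%N; exact: hdeg1.
exact: negbT (idealr1 p).
Qed.

Lemma hcomplM f g : f \in hcompl -> g \in hcompl -> f * g \in hcompl.
Proof.
move=> /andP[/asboolP[d fd] fp] /andP[/asboolP[e ge] gp]; apply/andP; split.
  by apply/asboolP; exists (d + e)%N; exact: hdegM.
by apply/negP => /prime_idealr_closed_subproof; rewrite [_ || _]negbTE ?negb_or ?fp.
Qed.

Lemma hcompl0 : 0 \notin hcompl.
Proof. by apply/negP => /andP[_ /negP[]]; exact: (idealr0 p). Qed.

Definition hcompl_mulset := MulSet hcompl1 hcomplM hcompl0.

Definition deg0 : {pred loc hcompl_mulset} :=
  [pred u | `[< exists d f g, [/\ hdeg d f, hdeg d g, g \in hcompl &
                  u = loc_of hcompl_mulset f / loc_of hcompl_mulset g] >]].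

Lemma deg0_subalg_closed : GRing.subalg_closed deg0.
Proof.
have Du g : g \in hcompl -> loc_of hcompl_mulset g \is a GRing.unit.
  by move=> gS; apply: (@loc_of_unit _ hcompl_mulset g gS).
split.
- apply/asboolP; exists 0%N, 1, 1; split; rewrite ?hcompl1 //; try exact: hdeg1.
  by rewrite rmorph1 divr1.
- move=> c u v /asboolP[d [f [g [df dg gS ->]]]] /asboolP[e [f' [g' [ef eg gS' ->]]]].
  apply/asboolP; exists (d + e)%N, (c *: (f * g') + f' * g), (g * g').
  split; last 1 first.
  + rewrite rmorphD /= loc_ofZ !rmorphM /= mulrDl invrM ?Du // -!scalerAl.
    congr (_ *: _ + _); first by rewrite -!mulrA mulVKr ?Du.
    by rewrite -!mulrA; congr (_ * _); rewrite mulrCA mulrV ?Du // mulr1.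
  + apply: hdegD; first by apply: hdegZ; apply: hdegM.
    by rewrite addnC; apply: hdegM.
  + exact: hdegM.
  + exact: hcomplM.
move=> u v /asboolP[d [f [g [df dg gS ->]]]] /asboolP[e [f' [g' [ef eg gS' ->]]]].
apply/asboolP; exists (d + e)%N, (f * f'), (g * g'); split.
- exact: hdegM.
- exact: hdegM.
- exact: hcomplM.
by rewrite !rmorphM /= invrM ?Du // mulrACA [_^-1 * _]mulrC.
Qed.

HB.instance Definition _ :=
  GRing.isSubalgClosed.Build K (loc hcompl_mulset) deg0
    (GRing.subalg_closed_semi deg0_subalg_closed).
HB.instance Definition _ :=
  GRing.isSubringClosed.Build (loc hcompl_mulset) deg0
    (GRing.subalg_closedBM deg0_subalg_closed).

(* O_{X,p} is the degree-zero part of the homogeneous localization of R at p. *)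
Definition local_ring : Type := {u : loc hcompl_mulset | u \in deg0}.
HB.instance Definition _ := [isSub of local_ring for @sval _ _].
HB.instance Definition _ := [Choice of local_ring by <:].
HB.instance Definition _ := [SubChoice_isSubComNzRing of local_ring by <:].
HB.instance Definition _ := [SubZmodule_isSubLmodule of local_ring by <:].
HB.instance Definition _ := [SubNzRing_SubLmodule_isSubLalgebra of local_ring by <:].
HB.instance Definition _ := GRing.Lalgebra_isComAlgebra.Build K local_ring.


(* For f in R_d, this is the image of f / x0 ^+ d in O_{X,p} (x0 is assumed not
   to lie in p).                                                              *)
Definition germ (d : nat) (f : hcr) : local_ring :=
  insubd 0 (loc_of hcompl_mulset f / loc_of hcompl_mulset x0 ^+ d).

(* The component at p of the map R -> prod_j O_{X,p_j}[T_j, T_j^-1]. *)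
Definition itilde (f : hcr) : laurent local_ring :=
  \sum_(d < msize (repr f)) germ d (hcomp d f) *: laurX local_ring ^+ d.
End LocalRing.

(* (0, ..., 0, a, 0, ..., 0), with a in position j. *)
Definition laurent_single s (p : 'I_s -> scheme_point) (j : 'I_s)
    (a : laurent (local_ring (p j))) : forall l, laurent (local_ring (p l)) :=
  dfwith (fun l => 0 : laurent (local_ring (p l))) a.

Definition hnzd : {pred hcr} :=
  [pred f | `[< homogeneous f /\ forall g, f * g = 0 -> g = 0 >]].

Lemma hnzd1 : 1 \in hnzd.
Proof.
apply/asboolP; split; first by exists 0%N; exact: hdeg1.
by move=> g; rewrite mul1r.
Qed.

Lemma hnzdM f g : f \in hnzd -> g \in hnzd -> f * g \in hnzd.
Proof.
move=> /asboolP[[d fd] f0] /asboolP[[e ge] g0]; apply/asboolP; split.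
  by exists (d + e)%N; exact: hdegM.
by move=> h; rewrite -mulrA => /f0/g0.
Qed.

Lemma hnzd0 : 0 \notin hnzd.
Proof.
by apply/asboolP => -[_ /(_ 1 (mul0r _))/eqP]; rewrite oner_eq0.
Qed.

Definition hnzd_mulset := MulSet hnzd1 hnzdM hnzd0.

(* Q^h(R), the localization at all homogeneous non-zerodivisors. *)
Definition Qh : Type := loc hnzd_mulset.
HB.instance Definition _ := GRing.ComUnitRing.on Qh.
HB.instance Definition _ := GRing.ComAlgebra.on Qh.

Definition toQh (f : hcr) : Qh := loc_of hnzd_mulset f.

Definition qdeg (d : int) : set Qh :=
  [set q | exists a b f g, [/\ hdeg a f, hdeg b g, g \in hnzd,
             a%:Z - b%:Z = d & q = toQh f / toQh g]].

(* The component at p of Q^h(R) -> prod_j O_{X,p_j}[T_j, T_j^-1]. *)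
Definition iota_Qh (p : scheme_point) (q : Qh) : laurent (local_ring p) :=
  loc_lift (itilde p) q.

(* L_0 = K[x0, x0^-1], and its structural map to Q^h(R). *)
Definition L0 : Type := laurent K.
HB.instance Definition _ := GRing.ComUnitRing.on L0.
HB.instance Definition _ := GRing.ComAlgebra.on L0.

Definition L0x : L0 := laurX K.
Definition L0_to_Qh (u : L0) : Qh :=
  loc_lift (fun P : {poly K} => toQh (horner_alg x0 P)) u.

Definition L0deg (d : int) : set L0 := [set u | exists c : K, u = c *: L0x ^ d].

Definition L0_linear (psi : Qh -> L0) : Prop :=
  forall u q q', psi (L0_to_Qh u * q + q') = u * psi q + psi q'.

Definition homL0_deg (d : int) (psi : Qh -> L0) : Prop :=
  L0_linear psi /\ forall m q, qdeg m q -> L0deg (m + d) (psi q).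

(* The graded module of sums of homogeneous L_0-linear maps. *)
Definition homL0 (psi : Qh -> L0) : Prop :=
  exists N (d : 'I_N -> int) (psi_ : 'I_N -> Qh -> L0),
    (forall l, homL0_deg (d l) (psi_ l)) /\
    forall q, psi q = \sum_l psi_ l q.

Definition homogeneous_trace_map (sigma : Qh -> L0) : Prop :=
  homL0_deg 0 sigma /\
  forall psi, homL0 psi -> exists! g : Qh, forall q, psi q = sigma (g * q).

Definition induced_trace_map s (p : 'I_s -> scheme_point)
    (sbar : forall j, {linear local_ring (p j) -> K^o}) (sigma : Qh -> L0) : Prop :=
  homogeneous_trace_map sigma /\
  forall q (a : forall j, local_ring (p j)),
    (forall j, iota_Qh (p j) q = (a j)%:A) ->
    sigma q = (\sum_j sbar j (a j) : K)%:A.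

(* The canonical module of R; K[x0] is {poly K}, acting on R through
   'X |-> x0.                                                                 *)

Definition Kxdeg (d : int) : set {poly K} :=
  [set P | P = 0 \/ exists (c : K) (k : nat), d = k%:Z /\ P = c *: 'X^k].

Definition homKx_deg (d : int) (phi : hcr -> {poly K}) : Prop :=
  (forall P f g, phi (horner_alg x0 P * f + g) = P * phi f + phi g) /\
  forall m f, hdeg m f -> Kxdeg (m%:Z + d) (phi f).

Definition omega_deg (d : int) (phi : hcr -> {poly K}) : Prop :=
  homKx_deg (d - 1) phi.

Definition omega (phi : hcr -> {poly K}) : Prop :=
  exists N (d : 'I_N -> int) (phi_ : 'I_N -> hcr -> {poly K}),
    (forall l, omega_deg (d l) (phi_ l)) /\
    forall f, phi f = \sum_l phi_ l f.

(* psi is phi (x) id_{L_0} on Q^h(R) = R_{x0} = R (x)_{K[x0]} L_0: the unique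
   L_0-linear map extending phi.                                              *)
Definition is_base_change (phi : hcr -> {poly K}) (psi : Qh -> L0) : Prop :=
  L0_linear psi /\ forall f, psi (toQh f) = laur_of (phi f).

(* Phi sigma phi is the element g of Q^h(R) with g * sigma = phi (x) id_{L_0};
   it exists and is unique when sigma is a homogeneous trace map.             *)
Definition Phi (sigma : Qh -> L0) (phi : hcr -> {poly K}) : Qh :=
  xget 0 [set g | is_base_change phi (fun q => sigma (g * q))].

Definition dedekind_complement (sigma : Qh -> L0) : set Qh :=
  [set g | exists2 phi, omega phi & g = Phi sigma phi].

(* r is the regularity index of X, if deg X = N. *)
Definition is_regularity_index (N r : nat) : Prop :=
  (forall i, (r <= i)%N -> has_dim (hdeg i) N) /\
  forall r', (forall i, (r' <= i)%N -> has_dim (hdeg i) N) -> (r <= r')%N.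
End CoordinateRing.

Arguments x0 {K n} X.
Arguments laurent_single {K n X s} p j a l.

(* Main.v *)
Require Import Defs.
From HB Require Import structures.
From mathcomp Require Import all_boot all_order all_algebra.
From mathcomp Require Import boolp classical_sets.
From mathcomp Require Import mpoly.
Import GRing.Theory.
Local Open Scope ring_scope.

Set Implicit Arguments.
Unset Strict Implicit.
Unset Printing Implicit Defensive.

(** For f in R_d write f_p for the germ of f at p.  The germs (f_p)_p determine
    f: in degree r because the f_jk, whose germs are independent, are deg X
    many and hence a basis of R_r; below r by saturation; above r because
    multiplication by a power of x0 maps R_r injectively, hence onto, the
    degree in question.  So x0 is a non-zerodivisor, and by the same dimension
    count every homogeneous non-zerodivisor divides a power of x0, that is,
    Q^h(R) = R_{x0}.  An L_0-linear map on Q^h(R) is then determined by its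
    values on the f_jk.  For g = x0^(i - 2r) * sum c_jk ft_jk, orthogonality of
    the dual bases gives sigma (g * f_jk) = c_jk x0^i = phi f_jk, so g * sigma
    is the base change of phi, that is, Phi phi = g. *)

(** * Fractions, Laurent polynomials and a spanning criterion *)

Lemma loc_liftE (R : comNzRingType) (S : mulset R) (B : comUnitRingType)
    (f : R -> B) (fM : {morph f : x y / x * y})
    (fU : {in mset S, forall t, f t \is a GRing.unit}) a t :
  t \in mset S -> loc_lift f (loc_of S a / loc_of S t) = f a / f t.
Proof.
move=> St; rewrite /loc_lift.
have := locE (mkfrac a St); rewrite numerE denomE => <-.
set x := mkfrac a St; set y := repr _.
(* The chosen representative agrees with [a / t] only up to a factor [u] of [S]; since [f u] is a
   unit, this factor cancels in [B]. *)
have /eqP/eq_locP[u Su] : \pi_(loc S)%qT y = \pi_(loc S)%qT x by exact: reprK.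
rewrite numerE denomE => /(congr1 f); rewrite !fM => /(mulrI (fU _ Su)) e.
have Ut := fU _ St; have Uy := fU _ (denomP y).
by apply: (mulIr Uy); rewrite divrK // mulrAC -e mulrK.
Qed.

Lemma laurX_unit (A : comNzRingType) : laurX A \is a GRing.unit.
Proof. by apply: loc_of_unit; apply/asboolP; exists 1%N. Qed.

(** The denominators are powers of ['X], which are monic and hence regular even when [A] has zero
    divisors. *)
Lemma laur_of_inj (A : comNzRingType) : injective (@laur_of A).
Proof.
move=> P Q /eqP/eq_locP[_ /asboolP[k ->]]; rewrite !numerE !denomE !mulr1.
exact: (monic_lreg (monicXn _ k)).
Qed.

Lemma laur_ofZ (A : comNzRingType) (a : A) P : laur_of (a *: P) = a *: laur_of P.
Proof. exact: loc_ofZ. Qed.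

Lemma laur_ofXn (A : comNzRingType) k : laur_of 'X^k = laurX A ^+ k.
Proof. exact: rmorphXn. Qed.

Lemma laur_monom_inj (A : comNzRingType) k :
  injective (fun a : A => a *: laurX A ^+ k).
Proof.
move=> a b /=; rewrite -laur_ofXn -!laur_ofZ => /(@laur_of_inj A)/polyP/(_ k).
by rewrite !coefZ coefXn eqxx !mulr1.
Qed.

Lemma laur_monomM (A : comNzRingType) (a b : A) k l :
  (a *: laurX A ^+ k) * (b *: laurX A ^+ l) = (a * b) *: laurX A ^+ (k + l).
Proof. by rewrite -scalerAl -scalerAr scalerA exprD. Qed.

(* Coordinates of [v] in the basis form a square matrix whose rows are free. *)
Lemma independent_spans (K : fieldType) (V : lmodType K) (W : set V) (m : nat)
    (T : finType) (v : T -> V) :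
  has_dim W m -> #|T| = m -> (forall t, W (v t)) ->
  (forall a : T -> K, \sum_t a t *: v t = 0 -> forall t, a t = 0) ->
  forall x, W x -> exists a : T -> K, x = \sum_t a t *: v t.
Proof.
move=> [b [_ Wb]] cT Wv free x Wx.
(* [choice] asks for a coordinate row for every [y]; outside [W] the zero row is a mere default. *)
have coord y : exists c : 'rV[K]_m, W y -> y = \sum_k c 0 k *: b k.
  case: (pselect (W y)) => [/Wb[c [yE _]]|nW]; last by exists 0.
  by exists (\row_k c k) => _; rewrite {1}yE; apply: eq_bigr => k _; rewrite mxE.
have /choice[c cE] := coord.
pose t_ (i : 'I_m) : T := enum_val (cast_ord (esym cT) i).
have t_bij : bijective t_.
  apply: bij_comp; first exact: enum_val_bij.
  by exists (cast_ord cT) => i; rewrite ?cast_ordK ?cast_ordKV.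
have [t' tK t'K] := t_bij.
pose M := \matrix_(i, k) c (v (t_ i)) 0 k : 'M[K]_m.
have comb (u : 'rV[K]_m) :
    \sum_i u 0 i *: v (t_ i) = \sum_k (u *m M) 0 k *: b k.
  under eq_bigr => i _ do rewrite (cE (v (t_ i))) // scaler_sumr.
  rewrite exchange_big /=; apply: eq_bigr => k _.
  by rewrite mxE scaler_suml; apply: eq_bigr => i _; rewrite !mxE scalerA.
have reindexT (a : T -> K) : \sum_i a (t_ i) *: v (t_ i) = \sum_t a t *: v t.
  by rewrite [RHS](reindex t_) //; exact: onW_bij.
have freeM : M \in unitmx.
  rewrite -row_free_unit -kermx_eq0; apply/eqP/row_matrixP => i.
  rewrite row0; set u := row i _.
  have uM : u *m M = 0 by apply/sub_kermxP; exact: row_sub.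
  have := comb u; rewrite uM [RHS]big1 => [e|k _]; last by rewrite mxE scale0r.
  have := free (fun t => u 0 (t' t)); rewrite -reindexT.
  under eq_bigr => j _ do rewrite tK.
  move=> /(_ e) u0; apply/rowP => j; rewrite [RHS]mxE.
  by have := u0 (t_ j); rewrite tK.
exists (fun t => (c x *m invmx M) 0 (t' t)); rewrite -reindexT.
under eq_bigr => j _ do rewrite tK.
by rewrite comb mulmxKV // -cE.
Qed.

(** * Homogeneous components, germs and the map [itilde] *)

Section Grading.
Variables (K : fieldType) (n : nat) (X : scheme K n).
Implicit Types (f g : hcr X) (d k : nat).

Lemma cls_eq0 F : cls X F = 0 <-> vanishing_ideal X F.
Proof.
have -> : vanishing_ideal X F = (F - 0 \in vanishing_ideal X) by rewrite subr0.
rewrite Quotient.idealrBE; split=> [h|/eqP h]; last by rewrite /cls h; exact: rmorph0.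
by apply/eqP; rewrite [LHS]h; exact/esym/(rmorph0 (cls X)).
Qed.

(** Two representatives of a class differ by an element of the vanishing ideal, which contains the
    homogeneous components of its elements; so [hcomp] does not depend on the [repr] in its
    definition. *)
Lemma hcomp_cls d F : hcomp d (cls X F) = cls X (pihomog mdeg d F).
Proof.
apply/eqP; rewrite -subr_eq0 -raddfB -pihomogB /=; apply/eqP/cls_eq0.
apply: vanishing_ideal_homog; apply/cls_eq0; rewrite raddfB /=.
by rewrite /cls reprK subrr.
Qed.

Lemma hcr_cls f : f = cls X (repr f).
Proof. by rewrite /cls reprK. Qed.

Lemma hcompD d f g : hcomp d (f + g) = hcomp d f + hcomp d g.
Proof.
by rewrite [f]hcr_cls [g]hcr_cls -raddfD !hcomp_cls pihomogD raddfD.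
Qed.

Lemma hcomp_hdeg d f : hdeg d (hcomp d f).
Proof. by exists (pihomog mdeg d (repr f)); first exact: pihomogP. Qed.

Lemma hcomp_id d f : hdeg d f -> hcomp d f = f.
Proof. by move=> [F hF ->]; rewrite hcomp_cls pihomog_dE. Qed.

Lemma hcomp_neq d k f : hdeg d f -> k != d -> hcomp k f = 0.
Proof.
move=> [F hF ->] kd; rewrite hcomp_cls (pihomog_ne0 _ hF) ?rmorph0 //.
by rewrite eq_sym.
Qed.

Lemma hcomp_large d f : (msize (repr f) <= d)%N -> hcomp d f = 0.
Proof.
move=> h; rewrite /hcomp.
have := pihomog_partitionE (mf := mdeg) (leqnn (msize (repr f))).
move=> /(congr1 (pihomog mdeg d)); rewrite raddf_sum /= big1 => [->|i _].
  exact: rmorph0.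
rewrite (pihomog_ne0 _ (pihomogP _ i _)) //.
by rewrite neq_ltn (leq_trans (ltn_ord i)).
Qed.

Lemma hcomp_partition f : f = \sum_(d < msize (repr f)) hcomp d f.
Proof.
rewrite {1}[f]hcr_cls {1}(pihomog_partitionE (mf := mdeg) (leqnn (msize (repr f)))).
by rewrite raddf_sum.
Qed.

Lemma hdeg0 d : hdeg d (0 : hcr X).
Proof. by exists 0; rewrite ?rmorph0 ?rpred0. Qed.

Lemma hdeg_sum d I (s : seq I) (P : pred I) (F : I -> hcr X) :
  (forall i, P i -> hdeg d (F i)) -> hdeg d (\sum_(i <- s | P i) F i).
Proof. by apply: big_ind; [exact: hdeg0 | move=> f g; exact: hdegD]. Qed.

Lemma hdeg_var l : hdeg 1 (hvar X l).
Proof. by exists 'X_l; rewrite // dhomogX /= mdeg1. Qed.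

Lemma hdeg_x0 k : hdeg k (x0 X ^+ k).
Proof.
elim: k => [|k IH]; first exact: hdeg1.
by rewrite exprS -add1n; apply: hdegM => //; exact: hdeg_var.
Qed.

Section Germ.
Variable p : scheme_point X.
Hypothesis x0p : ~~ p (x0 X).

Let lc (f : hcr X) := loc_of (hcompl_mulset p) f.

Lemma x0_hcompl k : x0 X ^+ k \in hcompl p.
Proof.
elim: k => [|k IH]; first exact: hcompl1.
rewrite exprS; apply: hcomplM => //; apply/andP; split=> //.
by apply/asboolP; exists 1%N; exact: hdeg_var.
Qed.

Let lcU k : lc (x0 X ^+ k) \is a GRing.unit.
Proof. exact: (loc_of_unit (S := hcompl_mulset p) (x0_hcompl k)). Qed.

(** For [f] of degree [d] the fraction has degree zero, so the default 0 of [insubd] is not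
    taken. *)
Lemma val_germ d f : hdeg d f -> val (germ p d f) = lc f / lc (x0 X ^+ d).
Proof.
move=> df; rewrite /germ -rmorphXn; apply: insubdK; apply/asboolP.
exists d, f, (x0 X ^+ d); split=> //; [exact: hdeg_x0 | exact: x0_hcompl].
Qed.

Lemma germD d f g : hdeg d f -> hdeg d g ->
  germ p d (f + g) = germ p d f + germ p d g.
Proof.
move=> df dg; apply: val_inj; rewrite raddfD /= !val_germ //; last exact: hdegD.
by rewrite /lc raddfD mulrDl.
Qed.

Lemma germZ d c f : hdeg d f -> germ p d (c *: f) = c *: germ p d f.
Proof.
move=> df; apply: val_inj; rewrite linearZ /= !val_germ //; last exact: hdegZ.
by rewrite /lc loc_ofZ scalerAl.
Qed.

Lemma germ0 d : germ p d 0 = 0.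
Proof. by rewrite -(scale0r 0) germZ ?scale0r //; exact: hdeg0. Qed.

Lemma germ_sum d I (s : seq I) (P : pred I) (F : I -> hcr X) :
  (forall i, hdeg d (F i)) ->
  germ p d (\sum_(i <- s | P i) F i) = \sum_(i <- s | P i) germ p d (F i).
Proof.
move=> dF; elim: s => [|i s IH]; first by rewrite !big_nil germ0.
rewrite !big_cons; case: ifP => // _.
by rewrite germD // ?IH //; apply: hdeg_sum.
Qed.

Lemma germM d k f g : hdeg d f -> hdeg k g ->
  germ p (d + k) (f * g) = germ p d f * germ p k g.
Proof.
move=> df dg; apply: val_inj; rewrite [RHS]rmorphM /= !val_germ //; last exact: hdegM.
have lcM a b : lc (a * b) = lc a * lc b by exact: rmorphM.
by rewrite (addnC d) exprD !lcM invrM ?lcU // mulrACA.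
Qed.

Lemma germ_x0 k : germ p k (x0 X ^+ k) = 1.
Proof.
apply: val_inj; rewrite val_germ; last exact: hdeg_x0.
by rewrite divrr ?lcU // [RHS]rmorph1.
Qed.

(** Since [x0] has germ 1, this compares germs taken in different degrees. *)
Lemma germ_x0M d k f : hdeg d f -> germ p (k + d) (x0 X ^+ k * f) = germ p d f.
Proof. by move=> df; rewrite germM ?germ_x0 ?mul1r //; exact: hdeg_x0. Qed.

(** The sum defining [itilde] stops at the size of a chosen representative; a common bound lets such
    sums be compared termwise. *)
Lemma itilde_widen M f : (msize (repr f) <= M)%N ->
  itilde p f = \sum_(d < M) germ p d (hcomp d f) *: laurX (local_ring p) ^+ d.
Proof.
move=> fM; rewrite /itilde
  (big_ord_widen _ (fun d => germ p d (hcomp d f) *: laurX _ ^+ d) fM).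
rewrite big_mkcond; apply: eq_bigr => d _; case: ltnP => // h.
by rewrite hcomp_large // germ0 scale0r.
Qed.

Lemma itildeD : {morph itilde p : f g / f + g}.
Proof.
move=> f g; pose M := maxn (msize (repr (f + g))) (maxn (msize (repr f)) (msize (repr g))).
rewrite !(@itilde_widen M) ?leq_max ?leqnn ?orbT // -big_split /=; apply: eq_bigr => d _.
by rewrite -scalerDl hcompD germD //; exact: hcomp_hdeg.
Qed.

Lemma itilde_hdeg d f : hdeg d f -> itilde p f = germ p d f *: laurX (local_ring p) ^+ d.
Proof.
move=> df; rewrite (@itilde_widen (maxn (msize (repr f)) d.+1)) ?leq_maxl //.
have dM : (d < maxn (msize (repr f)) d.+1)%N by rewrite leq_max leqnn orbT.
rewrite (bigD1 (Ordinal dM)) //= hcomp_id // big1 ?addr0 // => k kd.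
by rewrite (hcomp_neq df) ?germ0 ?scale0r.
Qed.

Lemma itilde_sum I (s : seq I) (F : I -> hcr X) :
  itilde p (\sum_(i <- s) F i) = \sum_(i <- s) itilde p (F i).
Proof.
apply: (big_morph _ itildeD).
by rewrite (itilde_hdeg (hdeg0 0)) germ0 scale0r.
Qed.

Lemma itildeM : {morph itilde p : f g / f * g}.
Proof.
move=> f g; rewrite [f in LHS]hcomp_partition [g in LHS]hcomp_partition.
rewrite big_distrlr /= itilde_sum [in RHS]/itilde big_distrlr /=; apply: eq_bigr => d _.
rewrite itilde_sum; apply: eq_bigr => k _.
have [df dg] := (hcomp_hdeg d f, hcomp_hdeg k g).
by rewrite (itilde_hdeg (hdegM df dg)) germM // laur_monomM.
Qed.

Lemma itilde_x0 k : itilde p (x0 X ^+ k) = laurX (local_ring p) ^+ k.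
Proof. by rewrite (itilde_hdeg (hdeg_x0 k)) germ_x0 scale1r. Qed.

(** [itilde p f] is the image of an ordinary polynomial with the germs as coefficients, and
    [laur_of] is injective. *)
Lemma itilde_eq0 f d : itilde p f = 0 -> germ p d (hcomp d f) = 0.
Proof.
have -> : itilde p f = laur_of (\poly_(k < msize (repr f)) germ p k (hcomp k f)).
  rewrite poly_def /laur_of raddf_sum; apply: eq_bigr => k _.
  by rewrite -laur_ofXn -laur_ofZ.
move=> e; have /polyP/(_ d) : \poly_(k < msize (repr f)) germ p k (hcomp k f) = 0.
  by apply: laur_of_inj; rewrite e; exact/esym/(rmorph0 (loc_of _)).
rewrite coef_poly coef0; case: ltnP => // h _.
by rewrite hcomp_large ?germ0.
Qed.

End Germ.
End Grading.

(** * Linear maps over K[x0] and over L_0, and the uniqueness of [Phi] *)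

Section LinearMaps.
Variables (K : fieldType) (n : nat) (X : scheme K n).
Implicit Types (f g : hcr X) (k : nat).

Lemma toQhM : {morph (@toQh K n X) : f g / f * g}. Proof. exact: rmorphM. Qed.
Lemma toQhD : {morph (@toQh K n X) : f g / f + g}. Proof. exact: rmorphD. Qed.
Lemma toQhX k : {morph (@toQh K n X) : f / f ^+ k}. Proof. exact: rmorphXn. Qed.

Lemma toQh_unit g : g \in @hnzd K n X -> toQh g \is a GRing.unit.
Proof. exact: (@loc_of_unit _ (hnzd_mulset X)). Qed.

Lemma horner_x0X : horner_alg (x0 X) 'X = x0 X.
Proof. by rewrite /horner_alg horner_morphX. Qed.

(** The target is L_0 instead of K[x0], so that both [phi] and the restriction to R of an L_0-linear
    map on Q^h(R) fall under this notion. *)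
Definition Kx_linear (A : hcr X -> L0 K) : Prop := forall P f g,
  A (horner_alg (x0 X) P * f + g) = laur_of P * A f + A g.

Lemma laur_of1 : laur_of (1 : {poly K}) = 1. Proof. exact: rmorph1. Qed.

Lemma Kx_linear0 A : Kx_linear A -> A 0 = 0.
Proof.
move=> /(_ 1 0 0); rewrite mulr0 addr0 laur_of1 mul1r => e.
by apply: (addrI (A 0)); rewrite addr0 -e.
Qed.

Lemma Kx_linearM A P f : Kx_linear A ->
  A (horner_alg (x0 X) P * f) = laur_of P * A f.
Proof. by move=> Al; have := Al P f 0; rewrite !addr0 Kx_linear0 // addr0. Qed.

Lemma Kx_linearD A : Kx_linear A -> {morph A : f g / f + g}.
Proof. by move=> Al f g; have := Al 1 f g; rewrite rmorph1 laur_of1 !mul1r. Qed.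

Lemma Kx_linear_x0 A k f : Kx_linear A -> A (x0 X ^+ k * f) = laurX K ^+ k * A f.
Proof.
by move=> Al; rewrite -laur_ofXn -Kx_linearM // rmorphXn /= horner_x0X.
Qed.

Lemma Kx_linearZ A a f : Kx_linear A -> A (a *: f) = a%:A * A f.
Proof.
move=> Al; have := Kx_linearM a%:P f Al.
by rewrite /horner_alg horner_morphC /= -alg_polyC laur_ofZ laur_of1 !mulr_algl.
Qed.

Lemma L0_linear_mul (psi : Qh X -> L0 K) (g : Qh X) :
  L0_linear psi -> L0_linear (fun q => psi (g * q)).
Proof. by move=> psil u q q'; rewrite mulrDr mulrCA psil. Qed.

Hypothesis x0_unit : toQh (x0 X) \is a GRing.unit.

Lemma L0_to_QhE P k : L0_to_Qh X (laur_of P / laurX K ^+ k) =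
  toQh (horner_alg (x0 X) P) / toQh (x0 X) ^+ k.
Proof.
have -> : laurX K ^+ k = loc_of (powX_mulset K) 'X^k by rewrite -laur_ofXn.
rewrite /L0_to_Qh loc_liftE.
- by rewrite rmorphXn /= horner_x0X toQhX.
- by move=> f g; rewrite rmorphM toQhM.
- by move=> _ /asboolP[m ->]; rewrite rmorphXn /= horner_x0X toQhX unitrX // x0_unit.
by apply/asboolP; exists k.
Qed.

Lemma L0_to_Qh_laur_of P : L0_to_Qh X (laur_of P) = toQh (horner_alg (x0 X) P).
Proof. by have := L0_to_QhE P 0; rewrite !expr0 !divr1. Qed.

Lemma L0_linear_Kx (psi : Qh X -> L0 K) :
  L0_linear psi -> Kx_linear (fun f => psi (toQh f)).
Proof. by move=> psil P f g; rewrite toQhD toQhM -L0_to_Qh_laur_of psil. Qed.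

Lemma L0_linear_x0 (psi : Qh X -> L0 K) k q : L0_linear psi ->
  psi (q / toQh (x0 X) ^+ k) = psi q / laurX K ^+ k.
Proof.
move=> psil; have psi0 : psi 0 = 0.
  by have /Kx_linear0 := L0_linear_Kx psil; rewrite [toQh 0](rmorph0 (loc_of _)).
have := psil (laur_of 1 / laurX K ^+ k) q 0.
by rewrite L0_to_QhE rmorph1 !addr0 psi0 laur_of1 [toQh 1](rmorph1 (loc_of _))
  !mul1r addr0 ![_^-1 * _]mulrC.
Qed.

Hypothesis Qh_x0 : forall q : Qh X, exists f k, q = toQh f / toQh (x0 X) ^+ k.

Lemma L0_linear_ext (psi psi' : Qh X -> L0 K) : L0_linear psi -> L0_linear psi' ->
  (forall f, psi (toQh f) = psi' (toQh f)) -> psi =1 psi'.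
Proof.
move=> psil psil' e q; have [f [k ->]] := Qh_x0 q.
by rewrite !L0_linear_x0 // e.
Qed.

(** If [g] and [g'] both represent the base change, then [g' - g] multiplies [sigma] to the zero
    map; the trace map property gives the zero map only one multiplier, namely 0. *)
Lemma Phi_unique sigma phi (g : Qh X) : homogeneous_trace_map sigma ->
  is_base_change phi (fun q => sigma (g * q)) -> Phi sigma phi = g.
Proof.
move=> [[sl _] s_basis] g_bc; apply: xget_unique => // g' g'_bc.
(* The zero map is the empty sum of homogeneous maps. *)
have homL0_0 : homL0 (fun _ : Qh X => 0 : L0 K).
  exists 0%N, (fun _ => 0), (fun _ _ => 0); split; first by case.
  by move=> q; rewrite big_ord0.
have [h [_ h_unique]] := s_basis _ homL0_0.
have s0 : sigma 0 = 0.
  by have /Kx_linear0 := L0_linear_Kx sl; rewrite [toQh 0](rmorph0 (loc_of _)).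
apply/eqP; rewrite -subr_eq0; apply/eqP.
rewrite -(h_unique 0) ?(h_unique (g' - g)) // => q; last by rewrite mul0r s0.
have ext : sigma (g' * q) = sigma (g * q).
  by apply: (L0_linear_ext g'_bc.1 g_bc.1) => f; rewrite g'_bc.2 g_bc.2.
(* The scalar -1 turns L_0-linearity into compatibility with subtraction. *)
have := sl (- 1) (g * q) (g' * q).
have -> : L0_to_Qh X (- 1) = -1.
  have := L0_to_Qh_laur_of (- 1); rewrite [laur_of _](rmorphN1 (loc_of _)) => ->.
  by rewrite rmorphN1; exact: (rmorphN1 (loc_of _)).
by rewrite !mulN1r addrC -mulrBl ext [_ + sigma _]addrC subrr => ->.
Qed.

End LinearMaps.

(** * Dimension counts from a family in R_r that is independent on germs *)

Section Regular.
Variables (K : fieldType) (n : nat) (X : scheme K n).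
Variables (s : nat) (p : 'I_s -> scheme_point X).
Hypothesis x0p : forall j, ~~ p j (x0 X).
Variables (N r : nat).
Hypothesis dimN : forall d, (r <= d)%N -> has_dim (hdeg d : set (hcr X)) N.
Variables (T : finType) (v : T -> hcr X).
Hypothesis cardT : #|T| = N.
Hypothesis v_deg : forall t, hdeg r (v t).
Hypothesis v_free : forall a : T -> K,
  (forall l, germ (p l) r (\sum_t a t *: v t) = 0) -> forall t, a t = 0.

Implicit Types (f g h : hcr X) (d k : nat).

Lemma hdeg_comb (a : T -> K) : hdeg r (\sum_t a t *: v t).
Proof. by apply: hdeg_sum => t _; apply: hdegZ. Qed.

(** The [g * v t] are independent and as many as the dimension of R_(d+r), so they span it. The
    assumption on [g] speaks of germs because independence of [v] does, and germs are not yet known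
    to determine an element. *)
Lemma mul_surj d g : hdeg d g ->
  (forall h, hdeg r h -> g * h = 0 -> forall l, germ (p l) r h = 0) ->
  forall f, hdeg (d + r) f ->
    exists a : T -> K, f = g * \sum_t a t *: v t.
Proof.
move=> dg g_inj f df.
have dimd : has_dim (hdeg (d + r) : set (hcr X)) N by apply: dimN; exact: leq_addl.
have gE (a : T -> K) : \sum_t a t *: (g * v t) = g * \sum_t a t *: v t.
  by rewrite mulr_sumr; apply: eq_bigr => t _; rewrite scalerAr.
have [||a ->] := independent_spans dimd cardT (v := fun t => g * v t) _ _ df.
- by move=> t; apply: hdegM.
- move=> a; rewrite gE => e; apply: v_free.
  by apply: g_inj e; exact: hdeg_comb.
by exists a; rewrite gE.
Qed.

Lemma x0_surj k f : hdeg (k + r) f ->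
  exists a : T -> K, f = x0 X ^+ k * \sum_t a t *: v t.
Proof.
apply: mul_surj; first exact: hdeg_x0.
by move=> h dh e l; rewrite -(germ_x0M (x0p l) k dh) e germ0.
Qed.

Lemma v_span f : hdeg r f -> exists a : T -> K, f = \sum_t a t *: v t.
Proof.
by move=> df; have [//|a ->] := @x0_surj 0 f; exists a; rewrite mul1r.
Qed.

Lemma germs_inj_r f : hdeg r f -> (forall l, germ (p l) r f = 0) -> f = 0.
Proof.
move=> /v_span[a ->] /v_free a0.
by rewrite big1 // => t _; rewrite a0 scale0r.
Qed.

Lemma germs_inj d f : hdeg d f -> (forall l, germ (p l) d f = 0) -> f = 0.
Proof.
move=> df f0; have [dr|rd] := leqP d r; last first.
  move: df f0; rewrite -(subnK (ltnW rd)) => /x0_surj[a ->] f0.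
  rewrite [X in _ * X]germs_inj_r ?mulr0 //; first exact: hdeg_comb.
  by move=> l; rewrite -(germ_x0M (x0p l) (d - r) (hdeg_comb a)).
(* For [d <= r], saturation applies: each monomial of degree [r - d] moves [f] into R_r, where
   vanishing germs force the product to be zero. *)
have [F _ fF] := df; rewrite fF; apply/cls_eq0/vanishing_ideal_saturated.
exists (r - d)%N => m dm; apply/cls_eq0; rewrite rmorphM /= -fF.
have dX : hdeg (r - d) (cls X 'X_[m]) by exists 'X_[m]; rewrite // dhomogX /= dm.
apply: germs_inj_r; first by rewrite -(subnK dr); exact: hdegM.
by move=> l; rewrite -{1}(subnK dr) germM // f0 mulr0.
Qed.

(** [itilde] sends [x0 ^+ k] to the unit T^k, so [itilde f] vanishes at every point; hence so do the
    germs of each component of [f]. *)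
Lemma x0_nzd k f : x0 X ^+ k * f = 0 -> f = 0.
Proof.
move=> e; rewrite (hcomp_partition f) big1 // => d _.
apply: (germs_inj (hcomp_hdeg d f)) => l; apply: itilde_eq0 => //.
have := itildeM (x0p l) (x0 X ^+ k) f.
rewrite e itilde_x0 // (itilde_hdeg (x0p l) (hdeg0 X 0)) germ0 // scale0r.
move/esym/(congr1 (fun u => (laurX (local_ring (p l)) ^+ k)^-1 * u)).
by rewrite mulr0 mulKr // unitrX // laurX_unit.
Qed.

Lemma x0_hnzd k : x0 X ^+ k \in @hnzd K n X.
Proof.
apply/asboolP; split; first by exists k; exact: hdeg_x0.
by move=> g; exact: x0_nzd.
Qed.

(** Multiplication by [g] maps R_r onto R_(d+r), which contains [x0 ^+ (d + r)]. *)
Lemma hnzd_dvd_x0 g : g \in @hnzd K n X -> exists h m, g * h = x0 X ^+ m.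
Proof.
move=> /asboolP[[d dg] gnz].
have [|a aE] := mul_surj dg _ (hdeg_x0 X (d + r)).
  by move=> h _ /gnz -> l; rewrite germ0.
by exists (\sum_t a t *: v t), (d + r)%N; rewrite aE.
Qed.

Lemma itilde_unit l : {in @hnzd K n X, forall g, itilde (p l) g \is a GRing.unit}.
Proof.
move=> g /hnzd_dvd_x0[h [m /(congr1 (itilde (p l)))]].
rewrite itildeM // itilde_x0 // => e.
have : itilde (p l) g * itilde (p l) h \is a GRing.unit.
  by rewrite e unitrX // laurX_unit.
by rewrite unitrM => /andP[].
Qed.

Lemma iota_QhE l f g : g \in @hnzd K n X ->
  iota_Qh (p l) (toQh f / toQh g) = itilde (p l) f / itilde (p l) g.
Proof.
by move=> gS; apply: loc_liftE => //; [exact: itildeM | exact: itilde_unit].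
Qed.

(** A denominator [g] with [g * h = x0 ^+ k] is replaced by [x0 ^+ k] on expanding the fraction by
    [h]. *)
Lemma Qh_x0 (q : Qh X) : exists f k, q = toQh f / toQh (x0 X) ^+ k.
Proof.
have [h [k hk]] := hnzd_dvd_x0 (denomP (repr q)).
exists (numer (repr q) * h), k.
rewrite -[q in LHS]reprK locE -toQhX -hk -/(toQh _) -/(toQh (denom _)).
have dU : toQh (denom (repr q)) \is a GRing.unit by apply/toQh_unit/denomP.
have hU : toQh h \is a GRing.unit.
  have : toQh (denom (repr q) * h) \is a GRing.unit.
    by rewrite hk toQh_unit // x0_hnzd.
  by rewrite toQhM unitrM => /andP[].
by rewrite !toQhM invrM // mulrA mulrK.
Qed.

(* Injectivity of multiplication by [x0] on the target reduces every degree to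
   degree [r]. *)
Lemma Kx_linear_eq0 A : Kx_linear A -> (forall t, A (v t) = 0) -> forall f, A f = 0.
Proof.
move=> Al Av f.
have A0 := Kx_linear0 Al.
have Ar (a : T -> K) : A (\sum_t a t *: v t) = 0.
  rewrite (big_morph A (Kx_linearD Al) A0) big1 // => t _.
  by rewrite Kx_linearZ // Av mulr0.
rewrite (hcomp_partition f) (big_morph A (Kx_linearD Al) A0) big1 // => d _.
(* The component times [x0 ^+ r] has degree [r + d], which [eq_ind] rewrites as [d + r]; the extra
   factor becomes the unit T^r of L_0 and cancels. *)
have [a e] := @x0_surj d _ (eq_ind _ (hdeg (X := X) ^~ _)
  (hdegM (hdeg_x0 X r) (hcomp_hdeg d f)) _ (addnC r d)).
have Ur : laurX K ^+ r \is a GRing.unit by rewrite unitrX // laurX_unit.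
by apply: (mulrI Ur); rewrite -Kx_linear_x0 // e Kx_linear_x0 // Ar !mulr0.
Qed.

Lemma Kx_linear_ext A B : Kx_linear A -> Kx_linear B ->
  (forall t, A (v t) = B (v t)) -> A =1 B.
Proof.
move=> Al Bl ABv f; apply/eqP; rewrite -subr_eq0; apply/eqP.
apply: (@Kx_linear_eq0 (fun f => A f - B f)) => [P g h|t]; last by rewrite ABv subrr.
by rewrite Al Bl mulrBr opprD addrACA.
Qed.

End Regular.

(** * Germs of elements concentrated at one point of the support *)

Section Blocks.
Variables (K : fieldType) (n : nat) (X : scheme K n).
Variables (s : nat) (p : 'I_s -> scheme_point X).
Hypothesis x0p : forall j, ~~ p j (x0 X).

Lemma germ_single d (g : hcr X) j (a : local_ring (p j)) : hdeg d g ->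
  (forall l, itilde (p l) g =
     laurent_single p j (a *: laurX (local_ring (p j)) ^+ d) l) ->
  germ (p j) d g = a /\ forall l, l != j -> germ (p l) d g = 0.
Proof.
move=> dg gE; split=> [|l lj]; apply: (@laur_monom_inj _ d) => /=.
  by rewrite -itilde_hdeg // gE /laurent_single dfwith_in.
by rewrite -itilde_hdeg // gE /laurent_single dfwith_out 1?eq_sym // scale0r.
Qed.

(** At [p l] only the block [j = l] contributes, the other elements having germ zero there. *)
Lemma germ_blocks d (nu : 'I_s -> nat) (f : forall j, 'I_(nu j) -> hcr X)
    (e : forall j, 'I_(nu j) -> local_ring (p j)) :
  (forall j k, hdeg d (f j k) /\ forall l, itilde (p l) (f j k) =
     laurent_single p j (e j k *: laurX (local_ring (p j)) ^+ d) l) ->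
  forall (a : forall j, 'I_(nu j) -> K) l,
    germ (p l) d (\sum_j \sum_k a j k *: f j k) = \sum_k a l k *: e l k.
Proof.
move=> fE a l; have df j k : hdeg d (a j k *: f j k) by apply/hdegZ/(fE j k).1.
rewrite germ_sum // => [|j]; last by apply: hdeg_sum.
rewrite (bigD1 l) //= [X in _ + X]big1 ?addr0 => [|j jl]; rewrite germ_sum //.
  apply: eq_bigr => k _; have [dfk fkE] := fE l k.
  by rewrite germZ // (germ_single dfk fkE).1.
apply: big1 => k _; have [dfk fkE] := fE j k.
by rewrite germZ // (germ_single dfk fkE).2 ?scaler0 // eq_sym.
Qed.
End Blocks.

Theorem proposition3p4 (K : fieldType) (n : nat) (X : scheme K n)
  (s : nat) (p : 'I_s -> scheme_point X)
  (hdim : zero_dimensional X)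
  (hsupp : is_support p)
  (hGor : forall j, gorenstein_local (local_ring (p j)))
  (hx0 : forall j, ~~ p j (x0 X))
  (nu : 'I_s -> nat)
  (e : forall j, 'I_(nu j) -> local_ring (p j))
  (he : forall j, is_basis setT (e j))
  (sbar : forall j, {linear local_ring (p j) -> K^o})
  (hsbar : forall j, trace_map (sbar j))
  (e' : forall j, 'I_(nu j) -> local_ring (p j))
  (he' : forall j, is_basis setT (e' j))
  (hdual : forall j (k k' : 'I_(nu j)), sbar j (e j k * e' j k') = (k == k')%:R)
  (r : nat)
  (hr : is_regularity_index X (\sum_j nu j)%N r)
  (f ft : forall j, 'I_(nu j) -> hcr X)
  (hf : forall j k, hdeg r (f j k) /\
     forall l, itilde (p l) (f j k) =
       laurent_single p j (e j k *: laurX (local_ring (p j)) ^+ r) l)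
  (hft : forall j k, hdeg r (ft j k) /\
     forall l, itilde (p l) (ft j k) =
       laurent_single p j (e' j k *: laurX (local_ring (p j)) ^+ r) l)
  (sigma : Qh X -> L0 K)
  (hsigma : induced_trace_map sbar sigma)
  (i : nat) (phi : hcr X -> {poly K})
  (hphi : omega_deg (i%:Z - r%:Z + 1) phi)
  (c : forall j, 'I_(nu j) -> K)
  (hc : forall j k, phi (f j k) = c j k *: 'X^i) :
  [/\ forall j, iota_Qh (p j) (Phi sigma phi) =
        \sum_(k < nu j)
          (c j k *: e' j k) *: laurX (local_ring (p j)) ^ (i%:Z - r%:Z),
      dedekind_complement sigma (Phi sigma phi),
      qdeg (i%:Z - r%:Z) (Phi sigma phi) &
      Phi sigma phi =
        toQh (x0 X) ^ (i%:Z - 2 * r%:Z) *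
        toQh (\sum_(j < s) \sum_(k < nu j) c j k *: ft j k)].
Proof.
(* The pairs (j, k) form one index type, so that the f_jk become a single family with deg X
   members. *)
pose T : finType := {j : 'I_s & 'I_(nu j)}; pose v (t : T) := f (tag t) (tagged t).
have cardT : #|T| = (\sum_j nu j)%N.
  rewrite card_tagged sumnE big_map big_enum /=.
  by apply: eq_bigr => j _; rewrite card_ord.
have v_deg t : hdeg r (v t) := (hf (tag t) (tagged t)).1.
have v_free (a : T -> K) :
    (forall l, germ (p l) r (\sum_t a t *: v t) = 0) -> forall t, a t = 0.
  pose a' j (k : 'I_(nu j)) := a (existT _ j k).
  move=> ga [l k]; rewrite -[a _]/(a' l k); have := ga l.
  have -> : \sum_t a t *: v t = \sum_j \sum_k a' j k *: f j k.
    by rewrite sig_big_dep; apply: eq_bigr => -[].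
  rewrite (germ_blocks hx0 hf a') => gl.
  (* Both the zero vector and [a' l] are coordinates of 0 in the basis [e l], so they coincide. *)
  have [w [_ w_unique]] := (he l).2 0 I.
  have w0 : w = 0 by apply: w_unique; rewrite big1 // => j _; rewrite ffunE scale0r.
  have /ffunP/(_ k) : w = finfun (a' l).
    by apply: w_unique; under eq_bigr => j _ do rewrite ffunE; rewrite gl.
  by rewrite w0 !ffunE.
pose dimN := hr.1.
have [sigmaT sigmaE] := hsigma.
have sl := sigmaT.1.1.
pose F := \sum_(j < s) \sum_(k < nu j) c j k *: ft j k.
have dF : hdeg r F.
  by apply: hdeg_sum => j _; apply: hdeg_sum => k _; apply/hdegZ/(hft j k).1.
have gF l : germ (p l) r F = \sum_k c l k *: e' l k := germ_blocks hx0 hft c l.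
have x0S := x0_hnzd hx0 dimN cardT v_deg v_free.
have x0U : toQh (x0 X) \is a GRing.unit := toQh_unit (x0S 1%N).
have QhE := Qh_x0 hx0 dimN cardT v_deg v_free.
have iotaE := iota_QhE hx0 dimN cardT v_deg v_free.
(* The claimed value of [Phi sigma phi], written with nonnegative exponents since [i - 2r] may be
   negative. *)
pose G := toQh (x0 X ^+ i * F) / toQh (x0 X ^+ (2 * r)).
have GE : G = toQh (x0 X) ^ (i%:Z - 2 * r%:Z) * toQh F.
  by rewrite exprzDr // -PoszM -exprnN -exprnP /G toQhM !toQhX mulrAC.
have G_f j k : sigma (G * toQh (f j k)) = laur_of (phi (f j k)).
  have -> : G * toQh (f j k) = toQh (x0 X ^+ i * (F * f j k)) / toQh (x0 X) ^+ (2 * r).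
    by rewrite /G -toQhX mulrAC -toQhM mulrA.
  rewrite L0_linear_x0 //.
  rewrite (Kx_linear_x0 i (F * f j k) (L0_linear_Kx x0U sl)) //.
  (* Only [x0 ^+ i] stays outside [sigma]. The denominator [x0 ^+ (2 * r)] goes back inside, so that
     the argument has degree zero and [sigmaE] expresses its value through the [sbar j]. *)
  rewrite -mulrA -(L0_linear_x0 x0U _ _ sl) -toQhX.
  have [dfk fkE] := hf j k.
  have [gfj gfl] := germ_single hx0 dfk fkE.
  (* The components of [F * f j k / x0 ^+ (2 * r)] are products of germs. They vanish away from
     [p j], and at [p j] duality of the bases leaves the coefficient [c j k]. *)
  rewrite (sigmaE _ (fun l => germ (p l) r F * germ (p l) r (f j k))) => [|l].
    rewrite (bigD1 j) //= [X in _ + X]big1 ?addr0 => [|l lj]; last first.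
      by rewrite gfl // mulr0 linear0.
    rewrite gfj gF mulr_suml linear_sum (bigD1 k) //= big1 => [|k' k'k].
      rewrite -scalerAl linearZ /= [e' _ _ * _]mulrC hdual eqxx.
      rewrite addr0 hc laur_ofZ laur_ofXn.
      by rewrite [X in X%:A]mulr1 mulr_algr.
    by rewrite -scalerAl linearZ /= [e' _ _ * _]mulrC hdual eq_sym (negPf k'k) scaler0.
  rewrite iotaE //= (itilde_hdeg (hx0 l) (hdegM dF dfk)) germM // itilde_x0 //.
  by rewrite mul2n addnn -scalerAl divrr // unitrX // laurX_unit.
have G_bc : is_base_change phi (fun q => sigma (G * q)).
  split; first exact: L0_linear_mul.
  apply: (Kx_linear_ext hx0 dimN cardT v_deg v_free
    (B := fun g => laur_of (phi g))) => [||[j k]].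
  - exact: (L0_linear_Kx x0U (L0_linear_mul G sl)).
  - by move=> P g h; rewrite hphi.1 /laur_of rmorphD rmorphM.
  - exact: G_f.
have PhiG := Phi_unique x0U QhE sigmaT G_bc; rewrite PhiG.
split=> [j||| //].
(* The exponent of T_j is [i + r - 2r = i - r], the summand [r] coming from the degree of [F]. *)
- rewrite iotaE // itildeM // !itilde_x0 // (itilde_hdeg (hx0 j) dF) gF.
  rewrite -scaler_suml -scalerAr -scalerAl; congr (_ *: _).
  have XU := laurX_unit (local_ring (p j)).
  by rewrite exprzDr // -exprnN -exprnP mul2n -addnn exprD invrM ?unitrX //
    mulrA mulrK ?unitrX.
- exists phi; last by rewrite PhiG.
  (* Being homogeneous, [phi] is a sum with a single term. *)
  by exists 1%N, (fun=> i%:Z - r%:Z + 1), (fun=> phi); split=> // g; rewrite big_ord1.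
exists (i + r)%N, (2 * r)%N, (x0 X ^+ i * F), (x0 X ^+ (2 * r)); split=> //.
- by apply: hdegM => //; exact: hdeg_x0.
- exact: hdeg_x0.
by rewrite mul2n -addnn !PoszD opprD addrA addrK.
Qed.
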